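(* Let $m\ge 2$ be an integer, let $\mathcal{R}_{m-1}\in\mathbb{K}\langle\langle\mathbb{X}\rangle\rangle$ be the $(m-1)$-headed hydra continued fraction, and let $\mathcal{P}_m$ be the generating series of $m$-distinct partitions. Then $$\mathcal{R}_{m-1}=X_0\,(\sigma^{m-1}\mathcal{P}_m)\,(\mathcal{P}_m)^{-1}$$ in $\mathbb{K}\langle\langle\mathbb{X}\rangle\rangle$. In commuting variables, $$\mathcal{R}_{m-1}(\mathbf{x},z)=z x_0\,\frac{\mathcal{P}_m(zx_m,zx_{m+1},zx_{m+2},\dots)}{\mathcal{P}_m(zx_1,zx_2,zx_3,\dots)},$$ and, as $q$-series, $$\mathcal{R}_{m-1}(z)=z\,\frac{\mathcal{P}_m(zq^{m-1})}{\mathcal{P}_m(z)}.$$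
   Context: $\mathbb{K}$ is a field of characteristic zero, $\mathbb{X}=\{X_0,X_1,X_2,\dots\}$, and $\mathbb{K}\langle\langle\mathbb{X}\rangle\rangle$ is the algebra of noncommutative formal power series in $\mathbb{X}$. For $\kappa=(k_1,\dots,k_\ell)\in\mathbb{N}^\ell$ ($\mathbb{N}\ni 0$) write $X_\kappa=X_{k_1}\cdots X_{k_\ell}$ (empty word $=1$) and $\langle R,X_\kappa\rangle$ for the coefficient of $X_\kappa$ in $R$. Convergence of series is coefficientwise eventual stabilization. Shift: $\sigma$ is the continuous algebra endomorphism with $\sigma X_i=X_{i+1}$. Shift-plethysm: for $S$ with zero constant term, $R\circ_s S=\sum_{\kappa}\langle R,X_\kappa\rangle(\sigma^{k_1}S)(\sigma^{k_2}S)\cdots(\sigma^{k_\ell}S)$. $m$-distinct partitions: $\mathcal{P}_m$ is the sum of the words $X_{\lambda_1}X_{\lambda_2}\cdots X_{\lambda_\ell}$ over all $\ell\ge0$ and all sequences of positive integers with $\lambda_{i+1}-\lambda_i\ge m$ for $1\le i<\ell$ (including the empty word and all single letters $X_k$, $k\ge1$). Hydra continued fraction: for $n\ge1$, $\mathcal{R}_n$ is the unique series with zero constant term satisfying $$\mathcal{R}_n=X_0\Big(\big[(1+X_n)^{-1}(1+X_{n-1})^{-1}\cdots(1+X_1)^{-1}\big]\circ_s\mathcal{R}_n\Big).$$ Commutative images: for a series $R$, $R(\mathbf{x},z)$ denotes its image under $X_k\mapsto zx_k$ with $z,x_0,x_1,\dots$ commuting variables, and $R(z)$ denotes its image under $X_k\mapsto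 zq^k$. For the series $\mathcal{P}_m$, which involves only $X_1,X_2,\dots$, $\mathcal{P}_m(y_1,y_2,y_3,\dots)$ denotes the result of substituting commuting quantities $y_k$ for $X_k$, $k\ge1$. *)

(* Defs.v *)
(* The classical layer of MathComp-Analysis provides the choice structure on
   power series, the sums over all words in [subst] and the definite
   description in [hydra]. *)
From HB Require Import structures.
From mathcomp Require Import all_boot all_order all_algebra fingroup.
From mathcomp Require Import finmap multiset.
From mathcomp Require Import mathcomp_extra boolp classical_sets fsbigop.

Set Implicit Arguments.
Unset Strict Implicit.
Unset Printing Implicit Defensive.

Import GRing.Theory.
Local Open Scope ring_scope.

(* Monoids of monomials: every element has finitely many factorizations, and
   1 is the only element of degree 0. *)
HB.mixin Record Monoid_isGraded M of Monoid M := {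
  splits : M -> seq (M * M);
  mdeg : M -> nat;
  splits_uniq : forall m, uniq (splits m);
  mem_splits : forall m p, (p \in splits m) = ((p.1 * p.2)%g == m);
  mdegM : forall a b : M, mdeg (a * b)%g = (mdeg a + mdeg b)%N;
  mdeg_eq0 : forall m : M, (mdeg m == 0%N) = (m == 1%g)
}.

#[short(type="gmonoidType")]
HB.structure Definition GMonoid := {M of Monoid_isGraded M & Monoid M}.

HB.mixin Record GMonoid_isCommutative M of GMonoid M := {
  gmulC : forall a b : M, (a * b)%g = (b * a)%g
}.

#[short(type="comGmonoidType")]
HB.structure Definition ComGMonoid :=
  {M of GMonoid_isCommutative M & GMonoid M}.

Definition word (V : Type) := seq V.

Section FreeMonoid.
Variable V : choiceType.

HB.instance Definition _ := Choice.on (word V).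
HB.instance Definition _ :=
  isMonoid.Build (word V) (@catA V) (@cat0s V) (@cats0 V).

Definition word_splits (w : word V) : seq (word V * word V) :=
  [seq (take i w, drop i w) | i <- iota 0 (size w).+1].

Fact word_splits_uniq w : uniq (word_splits w).
Proof.
rewrite map_inj_in_uniq ?iota_uniq // => i j.
rewrite !mem_iota !ltnS => /= hi hj [/(congr1 size)].
by rewrite !size_takel.
Qed.

Fact mem_word_splits w p : (p \in word_splits w) = (p.1 * p.2 == w)%g.
Proof.
apply/mapP/eqP => [[i _ ->]|]; first exact: cat_take_drop.
case: p => a b <-; exists (size a).
  by rewrite mem_iota add0n ltnS -[(_ * _)%g]/(a ++ b) size_cat leq_addr.
by rewrite -[(_ * _)%g]/(a ++ b) take_size_cat // drop_size_cat.
Qed.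

HB.instance Definition _ :=
  Monoid_isGraded.Build (word V) word_splits_uniq mem_word_splits
    (@size_cat V) (fun w => size_eq0 w).

End FreeMonoid.

(* Commutative monomials are finite multisets of variables. *)
Definition cmon (V : choiceType) := {mset V}%mset.

Section FreeCommutativeMonoid.
Variable V : choiceType.
Local Open Scope mset_scope.

HB.instance Definition _ := Choice.on (cmon V).
HB.instance Definition _ :=
  isMonoid.Build (cmon V) (@msetDA V) (@mset0D V) (@msetD0 V).

Definition cmon_splits (m : cmon V) : seq (cmon V * cmon V) :=
  undup [seq (seq_mset (take i t), seq_mset (drop i t))
        | t <- permutations (enum_mset m), i <- iota 0 (size (enum_mset m)).+1].

Fact seq_mset_cat (s t : seq V) : seq_mset (s ++ t) = seq_mset s `+` seq_mset t.
Proof. by apply/msetP => a; rewrite msetE2 !mset_seqE count_cat. Qed.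

Fact mem_cmon_splits m p : (p \in cmon_splits m) = (p.1 * p.2 == m)%g.
Proof.
rewrite mem_undup; apply/allpairsP/eqP => [[[t i] /= [tm _ ->]]|<-].
  rewrite -[LHS]seq_mset_cat cat_take_drop -[RHS]seq_mset_id.
  by apply/eq_seq_msetP; rewrite -mem_permutations.
case: p => a b; set s := enum_mset a ++ enum_mset b.
have sP : perm_eq s (enum_mset (a * b : cmon V)%g).
  by apply/eq_seq_msetP; rewrite seq_mset_cat !seq_mset_id.
exists (s, size (enum_mset a)); split; first by rewrite mem_permutations.
  by rewrite mem_iota add0n ltnS leq0n -(perm_size sP) size_cat leq_addr.
by rewrite take_size_cat // drop_size_cat // !seq_mset_id.
Qed.

Fact cmon_degM (a b : cmon V) :
  size (enum_mset (a * b : cmon V)%g)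
  = (size (enum_mset a) + size (enum_mset b))%N.
Proof.
rewrite -size_cat; apply/esym/perm_size/eq_seq_msetP.
by rewrite seq_mset_cat !seq_mset_id.
Qed.

Fact cmon_deg_eq0 (m : cmon V) : (size (enum_mset m) == 0%N) = (m == 1%g).
Proof.
rewrite size_eq0; apply/eqP/eqP => [m0|->]; last exact: enum_mset0.
by apply/msetP => a; rewrite mset0E -count_mem_mset m0.
Qed.

HB.instance Definition _ :=
  Monoid_isGraded.Build (cmon V) (fun m => undup_uniq _) mem_cmon_splits
    cmon_degM cmon_deg_eq0.
HB.instance Definition _ := GMonoid_isCommutative.Build (cmon V) (@msetDC V).

End FreeCommutativeMonoid.

Record pseries (M : Type) (K : Type) := PSeries { coef :> M -> K }.

Section PSeriesRing.
Variables (M : gmonoidType) (K : fieldType).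
Local Notation T := (pseries M K).
Implicit Types (f g h : T) (m : M) (a : K).

HB.instance Definition _ := gen_eqMixin T.
HB.instance Definition _ := gen_choiceMixin T.

Lemma psP f g : f =1 g <-> f = g.
Proof. by case: f g => [f] [g]; split=> [/funext/= ->|->]. Qed.

Definition ps_zero : T := PSeries (fun=> 0).
Definition ps_opp f : T := PSeries (fun m => - f m).
Definition ps_add f g : T := PSeries (fun m => f m + g m).
Definition ps_scale a f : T := PSeries (fun m => a * f m).
Definition ps_mul f g : T :=
  PSeries (fun m => \sum_(p <- splits m) f p.1 * g p.2).
Definition mon m : T := PSeries (fun n => (n == m)%:R).

Fact ps_addA : associative ps_add.
Proof. by move=> f g h; apply/psP => m /=; rewrite addrA. Qed.
Fact ps_addC : commutative ps_add.
Proof. by move=> f g; apply/psP => m /=; rewrite addrC. Qed.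
Fact ps_add0 : left_id ps_zero ps_add.
Proof. by move=> f; apply/psP => m /=; rewrite add0r. Qed.
Fact ps_addN : left_inverse ps_zero ps_opp ps_add.
Proof. by move=> f; apply/psP => m /=; rewrite addNr. Qed.

HB.instance Definition _ := GRing.isZmodule.Build T
  ps_addA ps_addC ps_add0 ps_addN.

Fact ps_mulA : associative ps_mul.
Proof.
move=> f g h; apply/psP => m /=.
under eq_bigr do rewrite big_distrr; under [RHS]eq_bigr do rewrite big_distrl.
pose F (t : M * M * M) := f t.1.1 * g t.1.2 * h t.2.
transitivity (\sum_(t <- [seq (p.1, r.1, r.2) | p <- splits m,
                                               r <- splits p.2]) F t).
  rewrite big_allpairs_dep; apply: eq_bigr => p _.
  by apply: eq_bigr => r _; rewrite /F /= mulrA.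
transitivity (\sum_(t <- [seq (r.1, r.2, p.2) | p <- splits m,
                                               r <- splits p.1]) F t).
  apply/perm_big/uniq_perm.
  - apply: allpairs_uniq_dep => [|p _|]; rewrite ?splits_uniq //.
    move=> u v /allpairsPdep[[a b] [[c d] [_ + ->]]].
    move=> + /allpairsPdep[[a' b'] [[c' d'] [_ + ->]]] /=.
    by rewrite !mem_splits /= => /eqP<- /eqP<- [-> -> ->].
  - apply: allpairs_uniq_dep => [|p _|]; rewrite ?splits_uniq //.
    move=> u v /allpairsPdep[[a b] [[c d] [_ + ->]]].
    move=> + /allpairsPdep[[a' b'] [[c' d'] [_ + ->]]] /=.
    by rewrite !mem_splits /= => /eqP<- /eqP<- [-> -> ->].
  move=> [[a b] c]; apply/allpairsPdep/allpairsPdep.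
    move=> [p [r [/= + + [-> -> ->]]]]; rewrite !mem_splits => /eqP pm /eqP rp.
    exists ((p.1 * r.1)%g, r.2), (p.1, r.1); rewrite !mem_splits /=.
    by rewrite -mulgA rp pm !eqxx.
  move=> [p [r [/= + + [-> -> ->]]]]; rewrite !mem_splits => /eqP pm /eqP rp.
  exists (r.1, (r.2 * p.2)%g), (r.2, p.2); rewrite !mem_splits /=.
  by rewrite mulgA rp pm !eqxx.
by rewrite big_allpairs_dep.
Qed.

Lemma ps_monMl (a : M) f m : ps_mul (mon a) f m =
  \sum_(p <- splits m | p.1 == a) f p.2.
Proof.
rewrite /= [RHS]big_mkcond; apply: eq_bigr => p _.
by case: eqP; rewrite ?mul1r ?mul0r.
Qed.

Lemma ps_monMr (a : M) f m : ps_mul f (mon a) m =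
  \sum_(p <- splits m | p.2 == a) f p.1.
Proof.
rewrite /= [RHS]big_mkcond; apply: eq_bigr => p _.
by case: eqP; rewrite ?mulr1 ?mulr0.
Qed.

Fact ps_mul1 : left_id (mon 1%g) ps_mul.
Proof.
move=> f; apply/psP => m; rewrite ps_monMl (big_rem (1%g, m)) /=; last first.
  by rewrite mem_splits /= mul1g.
rewrite eqxx big_seq_cond big1 ?addr0 // => -[x y] /=.
rewrite (rem_filter _ (splits_uniq m)) mem_filter mem_splits /=.
move=> /andP[/andP[ne /eqP xy] /eqP x1].
by rewrite -xy x1 mul1g eqxx in ne.
Qed.

Fact ps_mulr1 : right_id (mon 1%g) ps_mul.
Proof.
move=> f; apply/psP => m; rewrite ps_monMr (big_rem (m, 1%g)) /=; last first.
  by rewrite mem_splits /= mulg1.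
rewrite eqxx big_seq_cond big1 ?addr0 // => -[x y] /=.
rewrite (rem_filter _ (splits_uniq m)) mem_filter mem_splits /=.
move=> /andP[/andP[ne /eqP xy] /eqP y1].
by rewrite -xy y1 mulg1 eqxx in ne.
Qed.

Fact ps_mulDl : left_distributive ps_mul +%R.
Proof.
move=> f g h; apply/psP => m /=; rewrite -big_split.
by apply: eq_bigr => p _; rewrite mulrDl.
Qed.

Fact ps_mulDr : right_distributive ps_mul +%R.
Proof.
move=> f g h; apply/psP => m /=; rewrite -big_split.
by apply: eq_bigr => p _; rewrite mulrDr.
Qed.

Fact ps_one_neq0 : mon 1%g != 0.
Proof.
by apply/eqP => /psP/(_ 1%g)/= /eqP; rewrite eqxx oner_eq0.
Qed.

HB.instance Definition _ := GRing.Zmodule_isNzRing.Build T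
  ps_mulA ps_mul1 ps_mulr1 ps_mulDl ps_mulDr ps_one_neq0.

Fact ps_scaleA a b f : ps_scale a (ps_scale b f) = ps_scale (a * b) f.
Proof. by apply/psP => m /=; rewrite mulrA. Qed.
Fact ps_scale1 : left_id 1 ps_scale.
Proof. by move=> f; apply/psP => m /=; rewrite mul1r. Qed.
Fact ps_scaleDr : right_distributive ps_scale +%R.
Proof. by move=> a f g; apply/psP => m /=; rewrite mulrDr. Qed.
Fact ps_scaleDl f : {morph ps_scale^~ f : a b / a + b}.
Proof. by move=> a b; apply/psP => m /=; rewrite mulrDl. Qed.

HB.instance Definition _ := GRing.Zmodule_isLmodule.Build K T
  ps_scaleA ps_scale1 ps_scaleDr ps_scaleDl.

Fact ps_scaleAl a f g : a *: (f * g) = (a *: f) * g.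
Proof.
apply/psP => m /=; rewrite big_distrr.
by apply: eq_bigr => p _; rewrite /= mulrA.
Qed.
Fact ps_scaleAr a f g : a *: (f * g) = f * (a *: g).
Proof.
apply/psP => m /=; rewrite big_distrr.
by apply: eq_bigr => p _; rewrite /= mulrCA.
Qed.

HB.instance Definition _ := GRing.Lmodule_isLalgebra.Build K T ps_scaleAl.
HB.instance Definition _ := GRing.Lalgebra_isAlgebra.Build K T ps_scaleAr.

Lemma coef0 m : (0 : T) m = 0. Proof. by []. Qed.
Lemma coef1 m : (1 : T) m = (m == 1%g)%:R. Proof. by []. Qed.
Lemma coefN f m : (- f) m = - f m. Proof. by []. Qed.
Lemma coefD f g m : (f + g) m = f m + g m. Proof. by []. Qed.
Lemma coefB f g m : (f - g) m = f m - g m. Proof. by []. Qed.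
Lemma coefZ a f m : (a *: f) m = a * f m. Proof. by []. Qed.
Lemma coefM f g m : (f * g) m = \sum_(p <- splits m) f p.1 * g p.2.
Proof. by []. Qed.
Lemma coef_sum I (r : seq I) (P : pred I) (F : I -> T) m :
  (\sum_(i <- r | P i) F i) m = \sum_(i <- r | P i) F i m.
Proof. by elim/big_rec2: _ => // i y g _ <-. Qed.

Lemma coefM_unit f g : (f * g) 1%g = f 1%g * g 1%g.
Proof.
rewrite coefM (big_rem (1%g, 1%g)) /=; last by rewrite mem_splits /= mul1g.
rewrite big_seq big1 ?addr0 // => -[x y] /=.
rewrite (rem_filter _ (splits_uniq _)) mem_filter mem_splits /=.
move=> /andP[+ xy1].
have: (mdeg x + mdeg y == 0)%N by rewrite -mdegM mdeg_eq0.
by rewrite addn_eq0 !mdeg_eq0 => /andP[/eqP-> /eqP->]; rewrite eqxx.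
Qed.

Lemma coefX_small f n m : f 1%g = 0 -> (mdeg m < n)%N -> (f ^+ n) m = 0.
Proof.
move=> f0; elim: n m => // n IHn m; rewrite ltnS => mn; rewrite exprS coefM.
rewrite big_seq big1 // => -[x y]; rewrite mem_splits /= => /eqP xym.
have [->|x1] := eqVneq x 1%g; first by rewrite f0 mul0r.
rewrite IHn ?mulr0 // (leq_trans _ mn) // -xym mdegM -addn1 addnC leq_add2r.
by rewrite lt0n mdeg_eq0.
Qed.

(* For f = c (1 - t) with c != 0 and t without constant term, the inverse is
   c^-1 (1 + t + t^2 + ...); powers t^i with i > mdeg m vanish at m. *)
Definition ps_unit : pred T := fun f => f 1%g != 0.
Definition ps_geom f : T := 1 - (f 1%g)^-1 *: f.
Definition ps_inv f : T :=
  if ps_unit f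
  then PSeries (fun m => (f 1%g)^-1 * \sum_(i < (mdeg m).+1) (ps_geom f ^+ i) m)
  else f.

Lemma ps_geom0 f : ps_unit f -> ps_geom f 1%g = 0.
Proof. by move=> uf; rewrite coefB coef1 coefZ eqxx mulVf ?subrr. Qed.

Lemma ps_invE f n m : ps_unit f -> (mdeg m <= n)%N ->
  ps_inv f m = ((f 1%g)^-1 *: \sum_(i < n.+1) ps_geom f ^+ i) m.
Proof.
move=> uf mn; rewrite /ps_inv uf coefZ coef_sum /=; congr (_ * _).
rewrite [RHS](bigID (fun i : 'I_n.+1 => (i < (mdeg m).+1)%N)) /=.
rewrite [X in _ = _ + X]big1 ?addr0; last first.
  by move=> i; rewrite -ltnNge => hi; rewrite coefX_small ?ps_geom0.
by rewrite (big_ord_widen _ (fun i => (ps_geom f ^+ i) m) (_ : _ <= n.+1)%N).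
Qed.

Lemma mdeg_splits m p : p \in splits m ->
  (mdeg p.1 <= mdeg m)%N /\ (mdeg p.2 <= mdeg m)%N.
Proof.
by rewrite mem_splits => /eqP <-; rewrite mdegM leq_addr leq_addl.
Qed.

Lemma ps_geom_inv f n : ps_unit f ->
  f * ((f 1%g)^-1 *: \sum_(i < n) ps_geom f ^+ i) = 1 - ps_geom f ^+ n
  /\ ((f 1%g)^-1 *: \sum_(i < n) ps_geom f ^+ i) * f = 1 - ps_geom f ^+ n.
Proof.
move=> uf; set t := ps_geom f; set s := \sum_(i < n) _.
have ft : (f 1%g)^-1 *: f = 1 - t by rewrite subKr.
have ts : GRing.comm t s by apply: commr_sum => i _; apply: commrX.
have es : (1 - t) * s = 1 - t ^+ n by rewrite -opprB mulNr -subrX1 opprB.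
split; first by rewrite -scalerAr scalerAl ft.
by rewrite -scalerAl scalerAr ft -es mulrBl mulrBr mul1r mulr1 ts.
Qed.

Fact ps_mulV : {in ps_unit, left_inverse 1 ps_inv *%R}.
Proof.
move=> f uf; apply/psP => m.
transitivity ((1 - ps_geom f ^+ (mdeg m).+1) m); last first.
  by rewrite coefB coefX_small ?ps_geom0 ?subr0.
rewrite -(ps_geom_inv _ uf).2 !coefM; apply: eq_big_seq => p /mdeg_splits[hp _].
by rewrite (ps_invE uf hp).
Qed.

Fact ps_mulVr : {in ps_unit, right_inverse 1 ps_inv *%R}.
Proof.
move=> f uf; apply/psP => m.
transitivity ((1 - ps_geom f ^+ (mdeg m).+1) m); last first.
  by rewrite coefB coefX_small ?ps_geom0 ?subr0.
rewrite -(ps_geom_inv _ uf).1 !coefM; apply: eq_big_seq => p /mdeg_splits[_ hp].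
by rewrite (ps_invE uf hp).
Qed.

Fact ps_unitP f g : g * f = 1 /\ f * g = 1 -> ps_unit f.
Proof.
move=> [_ /psP/(_ 1%g)]; rewrite coefM_unit coef1 eqxx => fg1.
apply/eqP => f0; move: fg1; rewrite f0 mul0r => /esym/eqP.
by rewrite oner_eq0.
Qed.

Fact ps_inv_out : {in [predC ps_unit], ps_inv =1 id}.
Proof. by move=> f nuf; rewrite /ps_inv ifN. Qed.

HB.instance Definition _ := GRing.NzRing_hasMulInverse.Build T
  ps_mulV ps_mulVr ps_unitP ps_inv_out.

Lemma ps_unitE f : (f \is a GRing.unit) = (f 1%g != 0).
Proof. by []. Qed.

Lemma mon1 : mon 1%g = 1. Proof. by []. Qed.

Lemma monM (a b : M) : mon a * mon b = mon (a * b)%g.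
Proof.
apply/psP => m; rewrite [LHS]ps_monMl /=.
have [->|ne] := eqVneq m (a * b)%g; last first.
  rewrite big_seq_cond big1 // => -[x y]; rewrite mem_splits /=.
  case/andP => /eqP xym /eqP xa; case: eqP => // yb.
  by rewrite -xym xa yb eqxx in ne.
rewrite big_mkcond (big_rem (a, b)) /=; last by rewrite mem_splits.
rewrite !eqxx big_seq big1 ?addr0 // => -[x y].
rewrite (rem_filter _ (splits_uniq _)) mem_filter mem_splits /=.
move=> /andP[ne _]; case: (x =P a) => // xa; case: (y =P b) => // yb.
by rewrite xa yb eqxx in ne.
Qed.

Lemma mon_prod (I : Type) (r : seq I) (F : I -> M) :
  \prod_(i <- r) mon (F i) = mon (\prod_(i <- r) F i)%g.
Proof.
by elim: r => [|i r IHr]; rewrite ?big_nil // !big_cons IHr monM.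
Qed.

End PSeriesRing.

Arguments mon {M K} m.

Fact ps_mulC (M : comGmonoidType) (K : fieldType) (f g : pseries M K) :
  f * g = g * f.
Proof.
apply/psP => m; rewrite !coefM.
rewrite (perm_big [seq (p.2, p.1) | p <- splits m]) /=.
  by rewrite big_map; apply: eq_bigr => p _; rewrite mulrC.
apply: uniq_perm; rewrite ?splits_uniq //.
  by rewrite map_inj_uniq ?splits_uniq // => -[a b] [c d] [-> ->].
move=> [a b]; rewrite mem_splits /= gmulC; apply/idP/mapP => [ba|].
  by exists (b, a); rewrite ?mem_splits.
by move=> [[c d]]; rewrite mem_splits /= => + [-> ->].
Qed.

HB.instance Definition _ (M : comGmonoidType) (K : fieldType) :=
  GRing.PzRing_hasCommutativeMul.Build (pseries M K) (@ps_mulC M K).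

(* K<<X_0, X_1, ...>>: the letter X_k is the natural number k. *)
Definition ncseries (K : fieldType) := pseries (word nat) K.
HB.instance Definition _ (K : fieldType) :=
  GRing.UnitAlgebra.on (ncseries K).

Section Hydra.
Variable K : fieldType.
Implicit Types (R S : ncseries K).

Definition ncX (k : nat) : ncseries K := mon ([:: k] : word nat).

(* The image of R under X_k |-> y k, i.e. the sum over all words k_1 ... k_l of
   <R, X_{k_1} ... X_{k_l}> * y k_1 * ... * y k_l. The sum is taken separately
   for each coefficient. Caveat: an [fsbigop] sum with infinite support is 0,
   so this is meaningful when every coefficient receives finitely many nonzero
   contributions. That is the case for [shift], for [plethysm R S] when S has no
   constant term, for [xzimage], and for [qimage R t] when t is divisible by z
   (the degree in z bounds the length of w, the remaining variables its
   letters). *)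
Definition subst (M : gmonoidType) (y : nat -> pseries M K) R : pseries M K :=
  PSeries (fun m => \sum_(w \in [set: word nat]%classic)
                      R w * (\prod_(k <- w) y k) m).

Definition shift R : ncseries K := subst (fun k => ncX k.+1) R.

Definition plethysm R S : ncseries K := subst (fun k => iter k shift S) R.

(* The sequence lambda_1, ..., lambda_l has positive parts and
   lambda_(i+1) >= lambda_i + m. *)
Definition mdistinct (m : nat) (w : word nat) : bool :=
  all (ltn 0) w && sorted (fun a b => a + m <= b)%N w.

Definition Pser (m : nat) : ncseries K := PSeries (fun w => (mdistinct m w)%:R).

(* The factors are multiplied from left to right: n, n - 1, ..., 1. *)
Definition hydra_head (n : nat) : ncseries K :=
  \prod_(i < n) (1 + ncX (n - i))^-1.

Definition hydra_eq (n : nat) : set (ncseries K) := fun R =>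
  R [::] = 0 /\ R = ncX 0 * plethysm (hydra_head n) R.

(* The unique solution of hydra_eq n, by hydraP and hydra_unique below. *)
Definition hydra (n : nat) : ncseries K := xget 0 (hydra_eq n).

Definition agree (M : gmonoidType) (d : nat) (f g : pseries M K) :=
  forall m, (mdeg m < d)%N -> f m = g m.

Lemma agree_mul (M : gmonoidType) d (f f' g g' : pseries M K) :
  agree d f f' -> agree d g g' -> agree d (f * g) (f' * g').
Proof.
move=> ff gg m md; rewrite !coefM; apply: eq_big_seq => p /mdeg_splits[p1 p2].
by rewrite ff ?gg // (leq_ltn_trans _ md).
Qed.

Lemma agree_prod (M : gmonoidType) d (y y' : nat -> pseries M K) (s : seq nat) :
  (forall k, agree d (y k) (y' k)) ->
  agree d (\prod_(k <- s) y k) (\prod_(k <- s) y' k).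
Proof.
move=> yy; elim: s => [|k s IHs]; rewrite ?big_nil // !big_cons.
exact: agree_mul.
Qed.

Lemma agree_subst (M : gmonoidType) d (y y' : nat -> pseries M K) R :
  (forall k, agree d (y k) (y' k)) -> agree d (subst y R) (subst y' R).
Proof.
move=> yy m md /=; apply: eq_fsbigr => w _; congr (_ * _).
exact: (agree_prod (d := d)).
Qed.

Lemma prod_ncXS (w : word nat) :
  \prod_(k <- w) ncX k.+1 = mon (map succn w : word nat).
Proof.
rewrite mon_prod; congr mon.
by elim: w => [|k w IHw]; rewrite ?big_nil // big_cons IHw.
Qed.

Lemma agree_shift d R S : agree d R S -> agree d (shift R) (shift S).
Proof.
move=> RS w wd /=; apply: eq_fsbigr => u _; rewrite prod_ncXS /=.
case: eqP wd => [->|_] wd; last by rewrite !mulr0.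
by rewrite RS //; move: wd; rewrite {1}/mdeg /= size_map.
Qed.

Lemma agree_plethysm d R S S' :
  agree d S S' -> agree d (plethysm R S) (plethysm R S').
Proof.
by move=> SS; apply: agree_subst; elim=> //= k IHk; apply: agree_shift.
Qed.

Lemma agree_ncXM d k R S : agree d R S -> agree d.+1 (ncX k * R) (ncX k * S).
Proof.
move=> RS m md; rewrite !coefM; apply: eq_big_seq => p.
rewrite mem_splits /= => /eqP pm.
have [p1|_] := eqVneq p.1 [:: k]; last by rewrite !mul0r.
by rewrite RS // -ltnS (leq_ltn_trans _ md) // -pm p1.
Qed.

Lemma hydra_unique n R S : hydra_eq n R -> hydra_eq n S -> R = S.
Proof.
move=> [_ eR] [_ eS].
suff RS d : agree d R S by apply/psP => w; apply: (RS (mdeg w).+1).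
elim: d => // d IHd; rewrite eR eS; apply/agree_ncXM/agree_plethysm/IHd.
Qed.

Lemma hydraP n : hydra_eq n (hydra n).
Proof.
pose Phi R := ncX 0 * plethysm (hydra_head n) R.
have PhiP d R S : agree d R S -> agree d.+1 (Phi R) (Phi S).
  by move=> RS; apply/agree_ncXM/agree_plethysm.
have itP k j : agree k (iter k Phi 0) (iter (k + j) Phi 0).
  by elim: k => // k IHk; rewrite addSn; apply: PhiP.
pose R : ncseries K := PSeries (fun w => iter (mdeg w).+1 Phi 0 w).
have RP k : agree k R (iter k Phi 0).
  by move=> w wk; rewrite -(subnKC wk); apply: itP.
apply: xgetI (R) _; split.
  by rewrite [LHS](RP 1%N) // [LHS]coefM_unit mul0r.
apply/psP => w; rewrite [LHS](RP (mdeg w).+1) //= -/(Phi R).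
by apply/esym/PhiP => //; apply: RP.
Qed.

End Hydra.

(* Commutative power series in z and x_0, x_1, ...: None is z, Some k is x_k. *)
Definition xzseries (K : fieldType) := pseries (cmon (option nat)) K.
HB.instance Definition _ (K : fieldType) :=
  GRing.ComUnitRing.on (xzseries K).

(* Commutative power series in z and q: true is z, false is q. *)
Definition zqseries (K : fieldType) := pseries (cmon bool) K.
HB.instance Definition _ (K : fieldType) :=
  GRing.ComUnitRing.on (zqseries K).

Section CommutativeImages.
Variable K : fieldType.

Definition xz_z : xzseries K := mon ([mset None] : cmon (option nat))%mset.
Definition xz_x (k : nat) : xzseries K :=
  mon ([mset Some k] : cmon (option nat))%mset.
Definition zq_z : zqseries K := mon ([mset true] : cmon bool)%mset.
Definition zq_q : zqseries K := mon ([mset false] : cmon bool)%mset.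

(* R(x, z) *)
Definition xzimage (R : ncseries K) : xzseries K :=
  subst (fun k => xz_z * xz_x k) R.

(* R(t), where t may be any series in z and q, e.g. z or z q^(m-1) *)
Definition qimage (R : ncseries K) (t : zqseries K) : zqseries K :=
  subst (fun k => t * zq_q ^+ k) R.

End CommutativeImages.

(* Main.v *)
(* With Q k = sigma^k P_m, splitting off the smallest part gives
   Q k = Q (k+1) + X_(k+1) Q (k+m).  For R = X_0 Q (m-1) / Q 0 this says that
   1 + sigma^(k+1) R = Q k / Q (k+1), so the product of the inverses telescopes
   to Q (m-1) / Q 0 and R solves the equation defining the hydra.  Substituting
   commuting variables is a ring morphism, which turns this closed form into
   the two commutative identities. *)
From mathcomp Require Import all_boot all_algebra.
From mathcomp Require Import finmap multiset.
From mathcomp Require Import boolp classical_sets fsbigop.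
Require Import Defs.

Set Implicit Arguments.
Unset Strict Implicit.
Unset Printing Implicit Defensive.

Import GRing.Theory.
Local Open Scope ring_scope.

(** * Substitution as a ring morphism *)

Section SubstMorphism.
Variables (M : gmonoidType) (K : fieldType).
Implicit Types (y : nat -> pseries M K) (R S : ncseries K).

(* Only finitely many words contribute to each coefficient of [subst y R]. *)
Definition summable y : Prop := exists s : M -> seq (word nat),
  forall m w, (\prod_(k <- w) y k) m != 0 -> w \in s m.

(** Finite pool for [summable_small]: [d] exceeds the length of every word, and each letter is below
    [N] at the factor of [m] it accounts for. *)
Fixpoint short_words (N : M -> nat) (d : nat) (m : M) : seq (word nat) :=
  if d is d'.+1 then
    [::] :: flatten [seq [seq k :: w | k <- iota 0 (N p.1),
                                       w <- short_words N d' p.2]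
                    | p <- splits m]
  else [::].

(** Without constant terms every letter uses up positive degree, so at most [mdeg m] letters fit,
    and [N] leaves finitely many choices for each. *)
Lemma summable_small y (N : M -> nat) :
  (forall k, y k 1%g = 0) -> (forall k m, y k m != 0 -> (k < N m)%N) ->
  summable y.
Proof.
move=> y0 yN; exists (fun m => short_words N (mdeg m).+1 m) => m w.
have : (mdeg m < (mdeg m).+1)%N by [].
(* The first occurrence of [(mdeg m).+1] is the left side of [<]; only the upper bound and the
   recursion depth become [d]. *)
move: {2 3}(mdeg m).+1 => d; elim: d m w => // d IHd m [|k w] md //.
rewrite big_cons coefM => nz.
have [p pm] : exists2 p, p \in splits m &
    y k p.1 * (\prod_(k <- w) y k) p.2 != 0.
  apply: contrapT => none; case/eqP: nz; rewrite big_seq big1 // => p pm.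
  by apply/eqP/negPn/negP => nz; apply: none; exists p.
rewrite mulf_eq0 negb_or => /andP[yk yw].
rewrite inE /=; apply/flattenP.
exists [seq k' :: w' | k' <- iota 0 (N p.1), w' <- short_words N d p.2].
  by apply/mapP; exists p.
apply/allpairsP; exists (k, w); split=> //=.
  by rewrite mem_iota add0n yN.
apply: IHd => //; move: pm md; rewrite mem_splits => /eqP <-.
rewrite mdegM ltnS; apply: leq_trans; rewrite -[ltnLHS]add0n ltn_add2r lt0n.
by rewrite mdeg_eq0; apply: contraNneq yk => ->; rewrite y0.
Qed.

Lemma subst_seq y R (s : seq (word nat)) m : uniq s ->
  (forall w, (\prod_(k <- w) y k) m != 0 -> w \in s) ->
  subst y R m = \sum_(w <- s) R w * (\prod_(k <- w) y k) m.
Proof.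
move=> us ys; rewrite (bigfs _ (P := xpredT)) //=.
  by apply: eq_fsbigl; apply/seteqP; split.
by move=> w _ /(contraNeq (ys w)) ->; rewrite mulr0.
Qed.

Lemma substD y R S : summable y -> subst y (R + S) = subst y R + subst y S.
Proof.
move=> [s sP]; apply/psP => m; rewrite coefD.
rewrite !(@subst_seq _ _ (undup (s m))) ?undup_uniq //;
  try by move=> w; rewrite mem_undup; apply: sP.
by rewrite -big_split; apply: eq_bigr => w _; rewrite coefD mulrDl.
Qed.

Lemma subst_mon y (w : word nat) : subst y (mon w) = \prod_(k <- w) y k.
Proof.
apply/psP => m /=; rewrite (fsbigTE [fset w]%fset) /=.
  by rewrite big_seq_fset1 eqxx mul1r.
by move=> u; rewrite inE => /negPf ->; rewrite mul0r.
Qed.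

Lemma subst1 y : subst y 1 = 1.
Proof. by rewrite -mon1 subst_mon big_nil. Qed.

Lemma substX y k : subst y (ncX K k) = y k.
Proof. by rewrite subst_mon big_seq1. Qed.

(** Concatenation matches a word with a chosen splitting, on the left, to a pair of words, on the
    right. *)
Lemma substM y R S : summable y -> subst y (R * S) = subst y R * subst y S.
Proof.
move=> [s sP]; apply/psP => m; rewrite coefM.
pose F (p : word nat * word nat) :=
  R p.1 * S p.2 * (\prod_(k <- p.1 ++ p.2) y k) m.
(* Both sides become sums over finite sets of pairs of words in A x A. *)
pose A := undup (flatten [seq s p.1 ++ s p.2 | p <- splits m]
  ++ flatten [seq [seq q.1 | q <- splits w] ++ [seq q.2 | q <- splits w]
             | w <- s m]).
have uA : uniq A by apply: undup_uniq.
have sA p : p \in splits m -> {subset s p.1 <= A} /\ {subset s p.2 <= A}.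
  move=> pm; split=> w ws; rewrite mem_undup mem_cat; apply/orP; left;
    apply/flattenP; exists (s p.1 ++ s p.2); rewrite ?mem_cat ?ws ?orbT //;
    by apply/mapP; exists p.
have fA w q : w \in s m -> q \in splits w -> q.1 \in A /\ q.2 \in A.
  move=> ws qw; split; rewrite mem_undup mem_cat; apply/orP; right;
    apply/flattenP;
    exists ([seq q.1 | q <- splits w] ++ [seq q.2 | q <- splits w]);
    rewrite ?mem_cat ?map_f ?orbT //; by apply/mapP; exists w.
pose L := [seq q | w <- undup (s m), q <- splits w].
have uL : uniq L.
  apply: allpairs_uniq_dep => [|w _|]; rewrite ?undup_uniq ?splits_uniq //.
  move=> u v /allpairsPdep[a [p [_ + ->]]] /allpairsPdep[b [q [_ + ->]]] /=.
  by rewrite !mem_splits => /eqP <- /eqP <- ->.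
transitivity (\sum_(q <- L) F q).
  rewrite (@subst_seq _ _ (undup (s m))) ?undup_uniq //; last first.
    by move=> w; rewrite mem_undup; apply: sP.
  rewrite /L big_allpairs_dep; apply: eq_bigr => w _.
  rewrite coefM big_distrl; apply: eq_big_seq => q.
  by rewrite mem_splits /F => /eqP <-.
transitivity (\sum_(q <- [seq (u, v) | u <- A, v <- A]) F q); last first.
  rewrite big_allpairs_dep; apply/esym.
  transitivity (\sum_(p <- splits m) \sum_(u <- A) \sum_(v <- A)
    (R u * (\prod_(k <- u) y k) p.1) * (S v * (\prod_(k <- v) y k) p.2)).
    apply: eq_big_seq => p /sA[p1 p2].
    rewrite !(@subst_seq _ _ A) //; try by move=> w /sP; auto.
    by rewrite big_distrl; apply: eq_bigr => u _; rewrite big_distrr.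
  rewrite exchange_big; apply: eq_bigr => u _.
  rewrite exchange_big; apply: eq_bigr => v _.
  rewrite /F big_cat coefM big_distrr; apply: eq_bigr => p _ /=.
  by rewrite mulrACA.
(* A pair outside [L] has its concatenation outside [s m], so its product has coefficient 0 at
   [m]. *)
rewrite [RHS](bigID (mem L)) /= [X in _ = _ + X]big1 ?addr0; last first.
  move=> [u v]; rewrite /F /= => qL.
  apply/eqP; rewrite mulf_eq0; apply/orP; right.
  apply: contraNT qL => /sP uvs; apply/allpairsPdep.
  exists (u ++ v), (u, v); split; rewrite ?mem_undup //.
  by rewrite mem_splits.
rewrite -[RHS]big_filter; apply: perm_big; apply: uniq_perm => //.
  by rewrite filter_uniq // allpairs_uniq // => -[a b] [c d] _ _ [-> ->].
move=> [u v]; rewrite mem_filter; apply/idP/andP => [uvL|[]//].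
split=> //; case/allpairsPdep: (uvL) => w [q [ws qw quv]].
rewrite mem_undup in ws; have [qa qb] := fA _ _ ws qw.
by apply/allpairsP; exists (u, v); rewrite -quv in qa qb *.
Qed.

Lemma substV y R : summable y -> R [::] != 0 -> subst y R^-1 = (subst y R)^-1.
Proof.
move=> sy uR; have RV : subst y R * subst y R^-1 = 1.
  by rewrite -substM // divrr ?subst1.
have VR : subst y R^-1 * subst y R = 1.
  by rewrite -substM // mulVr ?subst1.
have uyR : subst y R \is a GRing.unit by apply/unitrP; exists (subst y R^-1).
by apply: (mulrI uyR); rewrite RV divrr.
Qed.

End SubstMorphism.

(** * The shift and its iterates as substitutions *)

Section Shift.
Variable K : fieldType.
Implicit Types (R S : ncseries K) (w : word nat).

(** Only [map predn w] can shift to [w], and it does so exactly when [w] has no letter 0, since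
    [predn] fixes 0. *)
Lemma shiftE R w :
  shift R w = if all (ltn 0) w then R (map predn w) else 0.
Proof.
rewrite [LHS](fsbigTE [fset map predn w]%fset) /= => [|u].
  rewrite big_seq_fset1 prod_ncXS /= -map_comp.
  have -> : (w == map (succn \o predn) w) = all (ltn 0) w.
    by elim: w => [|[|k] w] //= <-; rewrite eqseq_cons eqxx.
  by case: ifP; rewrite ?mulr1 ?mulr0.
rewrite inE prod_ncXS /=; case: (w =P _) => [->|_]; last by rewrite mulr0.
by rewrite -map_comp map_id eqxx.
Qed.

Lemma iter_shiftE n R w :
  iter n (@shift K) R w =
    if all (leq n) w then R (map (subn^~ n) w) else 0.
Proof.
elim: n w => [|n IHn] w.
  by rewrite (eq_map subn0) map_id (eq_all leq0n) all_predT.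
rewrite iterS shiftE IHn all_map -map_comp.
rewrite (eq_map (g := subn^~ n.+1)) => [|k /=]; last by rewrite -subn1 -subnDA.
case: allP => [w0|w0]; last first.
  case: allP => // wn; case: w0 => k /wn; exact: leq_trans.
have -> // : all (fun k => (n <= k.-1)%N) w = all (leq n.+1) w.
by apply: eq_in_all => k /w0; case: k.
Qed.

Lemma subst_shift (M : gmonoidType) (y : nat -> pseries M K) R :
  subst y (shift R) = subst (fun k => y k.+1) R.
Proof.
apply/psP => m /=.
rewrite -(fsbig_widen (range (map succn))) //; last first.
  move=> w /= [_ wS]; rewrite -[X in X * _]/(shift R w) shiftE.
  case: allP => w0; last by rewrite mul0r.
  case: wS; exists (map predn w) => //; rewrite -map_comp -[RHS]map_id.
  by apply/eq_in_map => k /w0; case: k.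
rewrite fsbig_image; last by move=> u v _ _; apply/inj_map/succn_inj.
apply: eq_fsbigr => w _; rewrite -[X in X * _]/(shift R (map succn w)) shiftE.
by rewrite all_map (eq_all (a2 := xpredT)) // all_predT -map_comp map_id
  big_map.
Qed.

Lemma subst_iter_shift (M : gmonoidType) (y : nat -> pseries M K) n R :
  subst y (iter n (@shift K) R) = subst (fun k => y (k + n)%N) R.
Proof.
elim: n y => [|n IHn] y; first by congr subst; apply/funext => k; rewrite addn0.
rewrite iterS subst_shift IHn; congr subst; apply/funext => k.
by rewrite addnS.
Qed.

Lemma prod_ncX w : \prod_(k <- w) ncX K k = mon w.
Proof.
rewrite mon_prod; congr mon.
by elim: w => [|k w IHw]; rewrite ?big_nil // big_cons IHw.
Qed.

Lemma subst_ncX R : subst (ncX K) R = R.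
Proof.
apply/psP => w; rewrite [LHS](fsbigTE [fset w]%fset) /= => [|u].
  by rewrite big_seq_fset1 prod_ncX /= eqxx mulr1.
by rewrite inE prod_ncX /= eq_sym => /negPf ->; rewrite mulr0.
Qed.

(** Writing an iterated shift as one substitution makes [substM] and [substV] available for it. *)
Lemma iter_shift n R :
  iter n (@shift K) R = subst (fun k => ncX K (k + n)) R.
Proof. by rewrite -subst_iter_shift subst_ncX. Qed.

Lemma summable_ncXD n : summable (fun k => ncX K (k + n)).
Proof.
apply: (@summable_small _ _ _ (fun w => (head 0 w).+1)) => // k w /=.
by case: (w =P _) => [->|_]; rewrite ?eqxx //= ltnS leq_addr.
Qed.

Lemma iter_shift_ncX n k : iter n (@shift K) (ncX K k) = ncX K (k + n).
Proof. by rewrite iter_shift substX. Qed.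

Lemma iter_shiftM n R S : iter n (@shift K) (R * S) =
  iter n (@shift K) R * iter n (@shift K) S.
Proof. by rewrite !iter_shift substM //; apply: summable_ncXD. Qed.

Lemma iter_shiftV n R : R [::] != 0 -> iter n (@shift K) R^-1 =
  (iter n (@shift K) R)^-1.
Proof. by move=> R0; rewrite !iter_shift substV //; apply: summable_ncXD. Qed.

(** Words in the support of [iter k shift S] are nonempty with letters at least [k], so the first
    letter bounds [k]. *)
Lemma summable_plethysm S : S [::] = 0 ->
  summable (fun k => iter k (@shift K) S).
Proof.
move=> S0.
apply: (@summable_small _ _ _ (fun w => (head 0 w).+1)) => [k|k w].
  by rewrite iter_shiftE.
rewrite iter_shiftE; case: w => [|a w] /=; first by rewrite S0 eqxx.
by rewrite ltnS; case: ifP => [/andP[]|_] //; rewrite eqxx.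
Qed.

Lemma coef_ncXM k R w :
  (ncX K k * R) w = if w is a :: u then (a == k)%:R * R u else 0.
Proof.
rewrite [LHS]ps_monMl; case: w => [|a w].
  by rewrite big_seq_cond big1 // => -[[|b u] v] /andP[]; rewrite mem_splits.
have aw : ([:: a] : word nat, w : word nat) \in splits (a :: w : word nat).
  by rewrite mem_splits.
rewrite big_mkcond (bigD1_seq _ aw (splits_uniq _)) /=.
rewrite big_seq_cond big1 ?addr0 => [|[u v]].
  by rewrite eqseq_cons andbT; case: eqP; rewrite ?mul1r ?mul0r.
rewrite mem_splits /= => /andP[/eqP uv]; case: (u =P _) => // u1.
by move: uv; rewrite u1 => -[-> ->]; rewrite eqxx.
Qed.

End Shift.

(** * Shifted series of $m$-distinct partitions and their recurrence *)

Section DistinctPartitions.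
Variables (K : fieldType) (m : nat).

Let Q n := iter n (@shift K) (Pser K m).

Lemma iter_shift_Pser n (w : word nat) :
  Q n w = (all (ltn n) w && sorted (fun a b => a + m <= b)%N w)%:R.
Proof.
rewrite /Q iter_shiftE /= /mdistinct all_map.
rewrite (eq_all (a1 := preim (subn^~ n) (ltn 0)) (a2 := ltn n)) => [|k];
  last exact: subn_gt0.
(* Truncated subtraction of [n] is sure to preserve gaps only on letters at least [n]; a smaller
   letter makes both sides 0. *)
case: (boolP (all (leq n) w)) => wn; last first.
  suff -> : all (ltn n) w = false by [].
  by apply: contraNF wn; apply: sub_all => k; apply: ltnW.
congr (nat_of_bool (_ && _))%:R; rewrite sorted_map.
apply: eq_in_sorted wn => a b; rewrite !unfold_in /= => an bn.
by rewrite addnBAC // leq_sub2rE.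
Qed.

Lemma Pser_nz n : Q n [::] != 0.
Proof. by rewrite iter_shift_Pser oner_eq0. Qed.

Lemma Pser_rec n : Q n = Q n.+1 + ncX K n.+1 * Q (n + m).
Proof.
apply/psP => -[|a u]; rewrite coefD coef_ncXM !iter_shift_Pser ?addr0 //=.
have tr : transitive (fun a b => a + m <= b)%N.
  by move=> y x z xy; apply: leq_trans; apply: leq_trans xy (leq_addr _ _).
rewrite !path_sortedE //.
(* Depending on its first letter, the word can count in neither term on the right ([a < n.+1]), only
   in the first ([a > n.+1]), or only in the product ([a = n.+1]). *)
case: (ltngtP a n.+1) => [an|na|->] /=.
- by rewrite mul0r addr0.
- rewrite mul0r addr0; congr (nat_of_bool _)%:R.
  case: (boolP (all _ _ && sorted _ _)) => [/andP[/allP au _]|_];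
    rewrite ?andbF //.
  have nu b : b \in u -> (n.+1 < b)%N.
    by move/au; apply: leq_trans; apply: leq_trans na (leq_addr _ _).
  by rewrite !andbT; apply: eq_in_all => b /nu nb; rewrite /= nb (ltnW nb).
rewrite add0r mul1r; congr (nat_of_bool _)%:R.
rewrite addSn -[all [eta leq _] u]/(all (ltn (n + m)) u) andbA.
rewrite [X in X && _]andb_idl //.
by apply: sub_all => b; apply: leq_trans; rewrite ltnS leq_addr.
Qed.

End DistinctPartitions.

(** * The closed form of the hydra, with $m = n + 1$ *)

Section HydraClosedForm.
Variables (K : fieldType) (n : nat).

Let Q k := iter k (@shift K) (Pser K n.+1).
Let R := ncX K 0 * Q n * (Q 0)^-1.

Let Q_unit k : Q k \is a GRing.unit.
Proof. exact: Pser_nz. Qed.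

Lemma iter_shift_hydra k : 1 + iter k.+1 (@shift K) R = Q k * (Q k.+1)^-1.
Proof.
rewrite /R !iter_shiftM iter_shiftV ?Pser_nz // iter_shift_ncX.
rewrite /Q -!iterD addn0 add0n.
(* Reading 1 as [Q k.+1 / Q k.+1] gives a common right denominator; the numerator is then the right
   side of [Pser_rec]. *)
rewrite -[X in X + _](divrr (Q_unit k.+1)) -mulrDl.
by rewrite [X in _ = X / _]Pser_rec addnS addSn addnC.
Qed.

Lemma hydra_closed_form : hydra K n = R.
Proof.
have R0 : R [::] = 0 by rewrite /R -mulrA [LHS]coef_ncXM.
have sR := summable_plethysm R0.
(* Here [R] stays fixed while [j] varies. The newest head multiplies on the left, so its image
   [Q j.+1 / Q j] cancels against [Q j / Q 0] without commutativity. *)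
have head j : plethysm (hydra_head K j) R = Q j * (Q 0)^-1.
  elim: j => [|j IHj].
    by rewrite /plethysm /hydra_head big_ord0 subst1 divrr.
  rewrite /hydra_head big_ord_recl subn0 /plethysm substM //.
  rewrite -/(hydra_head K j) -/(plethysm (hydra_head K j) R) IHj.
  rewrite substV ?coefD ?coef1 ?addr0 ?oner_eq0 // substD // subst1 substX.
  by rewrite iter_shift_hydra invrM ?unitrV // invrK mulrA divrK.
apply: (@hydra_unique _ n); first exact: hydraP.
by split=> //; rewrite head /R mulrA.
Qed.

(** Common source of both commutative identities: [subst y] is applied to the closed form factor by
    factor. *)
Lemma subst_hydra (M : gmonoidType) (y : nat -> pseries M K) : summable y ->
  subst y (hydra K n) =
  y 0 * (subst (fun k => y (k + n)%N) (Pser K n.+1) / subst y (Pser K n.+1)).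
Proof.
move=> sy; rewrite hydra_closed_form /R !substM // substX.
by rewrite substV ?(Pser_nz _ _ 0) // subst_iter_shift -mulrA.
Qed.

End HydraClosedForm.

(** * Summability of the commutative images, and the theorem *)

Lemma coefMl_eq0 (M : gmonoidType) (K : fieldType) (f g : pseries M K) :
  f 1%g = 0 -> (f * g) 1%g = 0.
Proof. by move=> f0; rewrite coefM_unit f0 mul0r. Qed.

Lemma mon_mset1_coef1 (K : fieldType) (V : choiceType) (x : V) :
  (mon ([mset x]%mset : cmon V) : pseries (cmon V) K) 1%g = 0.
Proof.
rewrite /=; case: (_ =P _) => // /esym x1.
have : x \in [mset x]%mset by rewrite in_mset1.
by rewrite x1 in_mset0.
Qed.

Lemma summable_xz (K : fieldType) : summable (fun k => xz_z K * xz_x K k).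
Proof.
(* The bound is one more than the largest index of an $x$ variable in [m]; [odflt] counts $z$ as
   0. *)
apply: (@summable_small _ _ _ (fun m : cmon (option nat) =>
  (\max_(v <- enum_mset m) odflt 0%N v).+1)) => [k|k m].
  by apply: coefMl_eq0; rewrite /xz_z (@mon_mset1_coef1 K (option nat) None).
rewrite monM /=; case: (m =P _) => [-> _|_]; last by rewrite eqxx.
rewrite ltnS; apply: (@leq_bigmax_seq _ _ xpredT (odflt 0%N) (Some k)) => //.
by rewrite in_msetD !in_mset1 eqxx orbT.
Qed.

(** All terms of [g ^+ k] have degree at least [k]; for $z q^k$ this bounds the letter [k] by the
    degree. *)
Lemma mulX_coef_neq0 (M : gmonoidType) (K : fieldType) (f g : pseries M K) k m :
  g 1%g = 0 -> (f * g ^+ k) m != 0 -> (k <= mdeg m)%N.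
Proof.
move=> g0; rewrite leqNgt; apply: contraNN => mk.
rewrite coefM big_seq big1 // => p /mdeg_splits[_ pm].
by rewrite coefX_small ?mulr0 // (leq_ltn_trans pm).
Qed.

Lemma summable_zq (K : fieldType) : summable (fun k => zq_z K * zq_q K ^+ k).
Proof.
apply: (@summable_small _ _ _ (fun m => (mdeg m).+1)) => [k|k m].
  by apply: coefMl_eq0; rewrite /zq_z (@mon_mset1_coef1 K bool true).
by apply: mulX_coef_neq0; rewrite /zq_q (@mon_mset1_coef1 K bool false).
Qed.

Theorem theorem15 (K : fieldType) (charK0 : [pchar K] =i pred0)
    (m : nat) (hm : (2 <= m)%N) :
  [/\ hydra K m.-1 = ncX K 0 * iter m.-1 (@shift K) (Pser K m) * (Pser K m)^-1,
      xzimage (hydra K m.-1) =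
        xz_z K * xz_x K 0 *
        (subst (fun k => xz_z K * xz_x K (k + m.-1)) (Pser K m)
         / subst (fun k => xz_z K * xz_x K k) (Pser K m))
    & qimage (hydra K m.-1) (zq_z K) =
        zq_z K *
        (qimage (Pser K m) (zq_z K * zq_q K ^+ m.-1)
         / qimage (Pser K m) (zq_z K))].
Proof.
case: m hm => // n _ /=; split.
- exact: hydra_closed_form.
- exact: subst_hydra (summable_xz K).
(* Evaluating [qimage] at $z q^n$ amounts to raising every index by [n]. *)
have zq : (fun k => zq_z K * zq_q K ^+ n * zq_q K ^+ k) =
          (fun k => zq_z K * zq_q K ^+ (k + n)).
  by apply/funext => k; rewrite addnC exprD mulrA.
have zq0 : zq_z K * zq_q K ^+ 0 = zq_z K by rewrite expr0 mulr1.
have := subst_hydra n (summable_zq K).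
by rewrite -zq zq0.
Qed.
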